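(* For each pair $(\mathsf G,\mathsf H)$ of groupoids, $\mathsf{FMor}(\mathsf G,\mathsf H)=(\mathrm{FMor}^1(\mathsf G,\mathsf H)\rightrightarrows \mathrm{FMor}^0(\mathsf G,\mathsf H))$, with the vertical composition $\tilde\bullet$ of arrows, is a groupoid.
   Context: A groupoid $\mathsf G=(G^1\rightrightarrows G^0)$ is a small category all of whose arrows are invertible; $G^0$ is the set of objects, $G^1$ the set of arrows, $s,t:G^1\to G^0$ are source and target, $G^1(a,b)$ is the set of arrows from $a$ to $b$. Composition is written from left to right: for $x\in G^1(a,b)$, $y\in G^1(b,c)$ one has $x\cdot y\in G^1(a,c)$. A strict morphism $\mathsf f=(f^0,f^1):\mathsf G\to\mathsf H$ is a functor. A natural transformation $\alpha:\mathsf f\Rightarrow\mathsf g$ is a map $\alpha:G^0\to H^1$ with $\alpha(a)\in H^1(f^0(a),g^0(a))$ and $f^1(x)\cdot\alpha(b)=\alpha(a)\cdot g^1(x)$ for $x\in G^1(a,b)$. A strict morphism $\mathsf f:\mathsf G\to\mathsf H$ is an equivalence if (1) every object of $H^0$ is the target of an arrow whose source lies in $f^0(G^0)$, and (2) $f^1:G^1(a,b)\to H^1(f^0(a),f^0(b))$ is bijective for all $a,b\in G^0$. A full-equivalence is an equivalence $\psi$ with $\psi^0$ surjective. Strict fiber product: for strict morphisms $\mathsf f_i:\mathsf G_i\to\mathsf H$, $i=1,2$, $\mathsf G_1\stackrel{\circ}{\times}_{\mathsf H}\mathsf G_2$ is the groupoid with objects $\{(a,b)\in G_1^0\times G_2^0: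 f_1^0(a)=f_2^0(b)\}$ and arrows $\{(x,y)\in G_1^1\times G_2^1: f_1^1(x)=f_2^1(y)\}$, with componentwise structure; $\tilde\pi_1,\tilde\pi_2$ denote its projections. $\mathrm{FMor}^0(\mathsf G,\mathsf H)$ is the set of full-morphisms $(\psi,\mathsf K,\mathsf u):\mathsf G\rightharpoonup\mathsf H$, i.e. pairs of strict morphisms $\mathsf G\xleftarrow{\psi}\mathsf K\xrightarrow{\mathsf u}\mathsf H$ with $\psi$ a full-equivalence. An arrow $(\psi_1,\mathsf K_1,\mathsf u_1)\xrightarrow{\alpha}(\psi_2,\mathsf K_2,\mathsf u_2)$ between full-morphisms is a natural transformation $\alpha:\mathsf u_1\circ\tilde\pi_1\Rightarrow\mathsf u_2\circ\tilde\pi_2:\mathsf K_1\stackrel{\circ}{\times}_{\mathsf G}\mathsf K_2\to\mathsf H$. $\mathrm{FMor}^1(\mathsf G,\mathsf H)$ is the disjoint union of the sets of such arrows over all pairs of full-morphisms. Vertical composition: for arrows $\alpha:(\psi_1,\mathsf K_1,\mathsf u_1)\to(\psi_2,\mathsf K_2,\mathsf u_2)$ and $\beta:(\psi_2,\mathsf K_2,\mathsf u_2)\to(\psi_3,\mathsf K_3,\mathsf u_3)$, $(\alpha\,\tilde\bullet\,\beta)(k_1,k_3)=\alpha(k_1,k_2)\cdot\beta(k_2,k_3)$ for any $k_2\in K_2^0$ with $\psi_1^0(k_1)=\psi_2^0(k_2)=\psi_3^0(k_3)$ (this is independent of the choice of $k_2$). *)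

(* Defs.v *)
From Stdlib Require Import ssreflect ssrfun ProofIrrelevance ClassicalEpsilon.

Set Implicit Arguments.
Unset Strict Implicit.
Unset Printing Implicit Defensive.

(* A groupoid is given by its source and target maps on one type of arrows
   (not by a family of hom types), so that the strict fiber product can compare
   arrows by plain equality.  The composite [mul x y e], written left to right,
   is defined exactly when [e : t x = s y]; the laws are quantified over all
   proofs of composability, which are provided by [mul_src], [mul_tgt],
   [one_src] and [one_tgt].

   These are predicates on the structure maps rather than a bundled type
   because the groupoid of full-morphisms lives one universe above the
   groupoids it is built from. *)
Record is_category (O A : Type) (s t : A -> O) (one : O -> A)
    (mul : forall x y : A, t x = s y -> A) : Prop := IsCategory {
  one_src : forall a, s (one a) = a;
  one_tgt : forall a, t (one a) = a;
  mul_src : forall x y e, s (mul x y e) = s x;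
  mul_tgt : forall x y e, t (mul x y e) = t y;
  mul_onel : forall x e, mul (one (s x)) x e = x;
  mul_oner : forall x e, mul x (one (t x)) e = x;
  mul_assoc : forall x y z exy eyz e1 e2,
    mul (mul x y exy) z e1 = mul x (mul y z eyz) e2
}.

Definition is_groupoid (O A : Type) (s t : A -> O) (one : O -> A)
    (mul : forall x y : A, t x = s y -> A) : Prop :=
  is_category one mul /\
  forall x, exists y (exy : t x = s y) (eyx : t y = s x),
    mul x y exy = one (s x) /\ mul y x eyx = one (t x).

Arguments is_groupoid {O A} s t one mul.

Record groupoid : Type := Groupoid {
  obj : Type;
  arr : Type;
  src : arr -> obj;
  tgt : arr -> obj;
  one : obj -> arr;
  mul : forall x y : arr, tgt x = src y -> arr;
  groupoidP : is_groupoid src tgt one mul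
}.

Arguments src {g} _.
Arguments tgt {g} _.
Arguments one {g} _.
Arguments mul {g} _ _ _.

Record morphism (G H : groupoid) : Type := Morphism {
  fobj : obj G -> obj H;
  farr : arr G -> arr H;
  f_src : forall x, src (farr x) = fobj (src x);
  f_tgt : forall x, tgt (farr x) = fobj (tgt x);
  f_one : forall a, farr (one a) = one (fobj a);
  f_mul : forall x y e e', farr (mul x y e) = mul (farr x) (farr y) e'
}.

Arguments f_mul {G H} _ {x y} e e'.

(* The composability proofs in [nt_nat] follow from [nt_src], [nt_tgt] and
   functoriality. *)
Record nat_trans (G H : groupoid) (f g : morphism G H) : Type := NatTrans {
  nt_map : obj G -> arr H;
  nt_src : forall a, src (nt_map a) = fobj f a;
  nt_tgt : forall a, tgt (nt_map a) = fobj g a;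
  nt_nat : forall x e e',
    mul (farr f x) (nt_map (tgt x)) e = mul (nt_map (src x)) (farr g x) e'
}.

Definition is_equivalence (G H : groupoid) (f : morphism G H) : Prop :=
  (forall b : obj H, exists y : arr H,
     (exists a : obj G, src y = fobj f a) /\ tgt y = b) /\
  (forall (a b : obj G) (y : arr H), src y = fobj f a -> tgt y = fobj f b ->
     exists! x : arr G, src x = a /\ tgt x = b /\ farr f x = y).

Definition is_full_equivalence (G H : groupoid) (f : morphism G H) : Prop :=
  is_equivalence f /\ forall b : obj H, exists a : obj G, fobj f a = b.

Section GroupoidTheory.
Variable G : groupoid.
Implicit Types (x y z : arr G) (a : obj G).

Lemma src_one a : src (one a) = a.
Proof. by case: (groupoidP G) => [[]]. Qed.
Lemma tgt_one a : tgt (one a) = a.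
Proof. by case: (groupoidP G) => [[]]. Qed.
Lemma src_mul x y e : src (mul x y e) = src x.
Proof. by case: (groupoidP G) => [[]]. Qed.
Lemma tgt_mul x y e : tgt (mul x y e) = tgt y.
Proof. by case: (groupoidP G) => [[]]. Qed.
Lemma mulA x y z exy eyz e1 e2 :
  mul (mul x y exy) z e1 = mul x (mul y z eyz) e2.
Proof. by case: (groupoidP G) => [[]]. Qed.

Lemma mul1 a x e : mul (one a) x e = x.
Proof.
have ea : a = src x by rewrite -e tgt_one.
by subst a; case: (groupoidP G) => [[]].
Qed.

Lemma mulx1 a x e : mul x (one a) e = x.
Proof.
have ea : tgt x = a by rewrite e src_one.
by subst a; case: (groupoidP G) => [[]].
Qed.

Lemma eq_mul x x' y y' e e' : x = x' -> y = y' -> mul x y e = mul x' y' e'.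
Proof. by move=> ex ey; subst x' y'; rewrite (proof_irrelevance _ e e'). Qed.
End GroupoidTheory.

Lemma eq_sig_val (T : Type) (P : T -> Prop) (u v : {x | P x}) :
  proj1_sig u = proj1_sig v -> u = v.
Proof.
case: u v => [x px] [y py] /= exy; subst y.
by rewrite (proof_irrelevance _ px py).
Qed.

Section Comp.
Variables (G H K : groupoid) (f : morphism G H) (g : morphism H K).

Lemma compm_src x : src (farr g (farr f x)) = fobj g (fobj f (src x)).
Proof. by rewrite f_src f_src. Qed.
Lemma compm_tgt x : tgt (farr g (farr f x)) = fobj g (fobj f (tgt x)).
Proof. by rewrite f_tgt f_tgt. Qed.
Lemma compm_one a : farr g (farr f (one a)) = one (fobj g (fobj f a)).
Proof. by rewrite f_one f_one. Qed.
Lemma compm_mul x y e e' :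
  farr g (farr f (mul x y e)) = mul (farr g (farr f x)) (farr g (farr f y)) e'.
Proof.
have e1 : tgt (farr f x) = src (farr f y) by rewrite f_tgt f_src e.
by rewrite (f_mul f e e1) (f_mul g e1 e').
Qed.

(* The composite written g o f in the usual notation. *)
Definition compm : morphism G K :=
  Morphism compm_src compm_tgt compm_one compm_mul.
End Comp.

Section FiberProduct.
Variables (G1 G2 H : groupoid) (f1 : morphism G1 H) (f2 : morphism G2 H).

Definition fp_obj : Type :=
  {p : obj G1 * obj G2 | fobj f1 (fst p) = fobj f2 (snd p)}.
Definition fp_arr : Type :=
  {p : arr G1 * arr G2 | farr f1 (fst p) = farr f2 (snd p)}.

Definition fp_fst (p : fp_obj) : obj G1 := fst (proj1_sig p).
Definition fp_snd (p : fp_obj) : obj G2 := snd (proj1_sig p).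
Definition fp_farr1 (z : fp_arr) : arr G1 := fst (proj1_sig z).
Definition fp_farr2 (z : fp_arr) : arr G2 := snd (proj1_sig z).

Definition fp_pair (a : obj G1) (b : obj G2) (e : fobj f1 a = fobj f2 b) :
  fp_obj := exist _ (a, b) e.
Definition fp_apair (x : arr G1) (y : arr G2) (e : farr f1 x = farr f2 y) :
  fp_arr := exist _ (x, y) e.

Lemma fp_src_subproof (z : fp_arr) :
  fobj f1 (src (fp_farr1 z)) = fobj f2 (src (fp_farr2 z)).
Proof. by rewrite -!f_src (proj2_sig z). Qed.
Lemma fp_tgt_subproof (z : fp_arr) :
  fobj f1 (tgt (fp_farr1 z)) = fobj f2 (tgt (fp_farr2 z)).
Proof. by rewrite -!f_tgt (proj2_sig z). Qed.
Lemma fp_one_subproof (p : fp_obj) :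
  farr f1 (one (fp_fst p)) = farr f2 (one (fp_snd p)).
Proof. by rewrite !f_one (proj2_sig p). Qed.

Definition fp_src (z : fp_arr) : fp_obj := fp_pair (fp_src_subproof z).
Definition fp_tgt (z : fp_arr) : fp_obj := fp_pair (fp_tgt_subproof z).
Definition fp_one (p : fp_obj) : fp_arr := fp_apair (fp_one_subproof p).

Section Mul.
Variables (z w : fp_arr) (e : fp_tgt z = fp_src w).

Definition fp_mul1_subproof : tgt (fp_farr1 z) = src (fp_farr1 w) :=
  f_equal fp_fst e.
Definition fp_mul2_subproof : tgt (fp_farr2 z) = src (fp_farr2 w) :=
  f_equal fp_snd e.

Lemma fp_mul_subproof :
  farr f1 (mul (fp_farr1 z) (fp_farr1 w) fp_mul1_subproof) =
  farr f2 (mul (fp_farr2 z) (fp_farr2 w) fp_mul2_subproof).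
Proof.
have e1 : tgt (farr f1 (fp_farr1 z)) = src (farr f1 (fp_farr1 w)).
  by rewrite f_tgt f_src fp_mul1_subproof.
have e2 : tgt (farr f2 (fp_farr2 z)) = src (farr f2 (fp_farr2 w)).
  by rewrite f_tgt f_src fp_mul2_subproof.
rewrite (f_mul f1 fp_mul1_subproof e1) (f_mul f2 fp_mul2_subproof e2).
by apply: eq_mul; [exact: (proj2_sig z) | exact: (proj2_sig w)].
Qed.

Definition fp_mul : fp_arr := fp_apair fp_mul_subproof.
End Mul.

Lemma fp_obj_eq (p q : fp_obj) :
  fp_fst p = fp_fst q -> fp_snd p = fp_snd q -> p = q.
Proof.
move=> e1 e2; apply: eq_sig_val; move: e1 e2; rewrite /fp_fst /fp_snd.
by case: (proj1_sig p) => ? ?; case: (proj1_sig q) => ? ? /= -> ->.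
Qed.

Lemma fp_arr_eq (z w : fp_arr) :
  fp_farr1 z = fp_farr1 w -> fp_farr2 z = fp_farr2 w -> z = w.
Proof.
move=> e1 e2; apply: eq_sig_val; move: e1 e2; rewrite /fp_farr1 /fp_farr2.
by case: (proj1_sig z) => ? ?; case: (proj1_sig w) => ? ? /= -> ->.
Qed.

Lemma fp_groupoidP : is_groupoid fp_src fp_tgt fp_one fp_mul.
Proof.
split; first split.
- by move=> p; apply: fp_obj_eq; apply: src_one.
- by move=> p; apply: fp_obj_eq; apply: tgt_one.
- by move=> z w e; apply: fp_obj_eq; apply: src_mul.
- by move=> z w e; apply: fp_obj_eq; apply: tgt_mul.
- by move=> z e; apply: fp_arr_eq; apply: mul1.
- by move=> z e; apply: fp_arr_eq; apply: mulx1.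
- by move=> *; apply: fp_arr_eq; apply: mulA.
- move=> z; case: (groupoidP G1) => _ /(_ (fp_farr1 z)) [y1 [a1 [b1 [c1 d1]]]].
  case: (groupoidP G2) => _ /(_ (fp_farr2 z)) [y2 [a2 [b2 [c2 d2]]]].
  have ez : farr f1 (fp_farr1 z) = farr f2 (fp_farr2 z) by exact: (proj2_sig z).
  have ey : farr f1 y1 = farr f2 y2.
    have p1 : tgt (farr f1 y1) = src (farr f1 (fp_farr1 z)).
      by rewrite f_tgt f_src b1.
    have p2 : tgt (farr f1 (fp_farr1 z)) = src (farr f2 y2).
      by rewrite ez f_tgt f_src a2.
    have p2' : tgt (farr f2 (fp_farr2 z)) = src (farr f2 y2).
      by rewrite f_tgt f_src a2.
    have q1 : mul _ _ p1 = one (fobj f1 (tgt (fp_farr1 z))).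
      by rewrite -(f_mul f1 b1 p1) d1 f_one.
    have q2 : mul _ _ p2 = one (fobj f2 (src (fp_farr2 z))).
      by rewrite -f_one -c2 (f_mul f2 a2 p2'); apply: eq_mul.
    have r1 : tgt (mul _ _ p1) = src (farr f2 y2) by rewrite tgt_mul.
    have r2 : tgt (farr f1 y1) = src (mul _ _ p2) by rewrite src_mul.
    have := mulA r1 r2.
    have s1 : tgt (one (fobj f1 (tgt (fp_farr1 z)))) = src (farr f2 y2).
      by rewrite -q1.
    have s2 : tgt (farr f1 y1) = src (one (fobj f2 (src (fp_farr2 z)))).
      by rewrite -q2.
    rewrite (eq_mul r1 s1 q1 erefl) (eq_mul r2 s2 erefl q2).
    by rewrite mul1 mulx1.
  have exy : fp_tgt z = fp_src (fp_apair ey) by apply: fp_obj_eq.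
  have eyx : fp_tgt (fp_apair ey) = fp_src z by apply: fp_obj_eq.
  exists (fp_apair ey), exy, eyx; split; apply: fp_arr_eq => /=.
  + by apply: (etrans _ c1); apply: eq_mul.
  + by apply: (etrans _ c2); apply: eq_mul.
  + by apply: (etrans _ d1); apply: eq_mul.
  + by apply: (etrans _ d2); apply: eq_mul.
Qed.

Definition fiber_product : groupoid := Groupoid fp_groupoidP.

Lemma fp_mul1 (x y : arr fiber_product) e e' :
  fp_farr1 (mul x y e) = mul (fp_farr1 x) (fp_farr1 y) e'.
Proof. exact: eq_mul. Qed.
Lemma fp_mul2 (x y : arr fiber_product) e e' :
  fp_farr2 (mul x y e) = mul (fp_farr2 x) (fp_farr2 y) e'.
Proof. exact: eq_mul. Qed.

Definition fp_proj1 : morphism fiber_product G1 :=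
  @Morphism fiber_product G1 fp_fst fp_farr1
    (fun _ => erefl) (fun _ => erefl) (fun _ => erefl) fp_mul1.
Definition fp_proj2 : morphism fiber_product G2 :=
  @Morphism fiber_product G2 fp_snd fp_farr2
    (fun _ => erefl) (fun _ => erefl) (fun _ => erefl) fp_mul2.
End FiberProduct.

Record full_morphism (G H : groupoid) : Type := FullMorphism {
  fm_mid : groupoid;
  fm_psi : morphism fm_mid G;
  fm_u : morphism fm_mid H;
  fm_full : is_full_equivalence fm_psi
}.

Definition fm_arrow (G H : groupoid) (m1 m2 : full_morphism G H) : Type :=
  nat_trans (compm (fp_proj1 (fm_psi m1) (fm_psi m2)) (fm_u m1))
            (compm (fp_proj2 (fm_psi m1) (fm_psi m2)) (fm_u m2)).

Section FullMorphisms.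
Variables G H : groupoid.
Implicit Types m : full_morphism G H.

Definition fm_app m1 m2 (al : fm_arrow m1 m2)
    (k1 : obj (fm_mid m1)) (k2 : obj (fm_mid m2))
    (e : fobj (fm_psi m1) k1 = fobj (fm_psi m2) k2) : arr H :=
  nt_map al (fp_pair e).

Lemma fm_app_src m1 m2 (al : fm_arrow m1 m2) k1 k2
    (e : fobj (fm_psi m1) k1 = fobj (fm_psi m2) k2) :
  src (fm_app al e) = fobj (fm_u m1) k1.
Proof. exact: (nt_src al). Qed.

Lemma fm_app_tgt m1 m2 (al : fm_arrow m1 m2) k1 k2
    (e : fobj (fm_psi m1) k1 = fobj (fm_psi m2) k2) :
  tgt (fm_app al e) = fobj (fm_u m2) k2.
Proof. exact: (nt_tgt al). Qed.

Lemma fm_app_nat m1 m2 (al : fm_arrow m1 m2) (x1 : arr (fm_mid m1))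
    (x2 : arr (fm_mid m2)) k1 k1' k2 k2'
    (ex : farr (fm_psi m1) x1 = farr (fm_psi m2) x2)
    (s1 : src x1 = k1) (t1 : tgt x1 = k1') (s2 : src x2 = k2) (t2 : tgt x2 = k2')
    (e : fobj (fm_psi m1) k1 = fobj (fm_psi m2) k2)
    (e' : fobj (fm_psi m1) k1' = fobj (fm_psi m2) k2') p q :
  mul (farr (fm_u m1) x1) (fm_app al e') p =
  mul (fm_app al e) (farr (fm_u m2) x2) q.
Proof.
subst k1 k1' k2 k2'.
pose z := fp_apair ex.
have es : fp_src z = fp_pair e by apply: fp_obj_eq.
have et : fp_tgt z = fp_pair e' by apply: fp_obj_eq.
have hs : nt_map al (fp_src z) = fm_app al e by rewrite es.
have ht : nt_map al (fp_tgt z) = fm_app al e' by rewrite et.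
have p' : tgt (farr (fm_u m1) x1) = src (nt_map al (fp_tgt z)) by rewrite ht.
have q' : tgt (nt_map al (fp_src z)) = src (farr (fm_u m2) x2) by rewrite hs.
rewrite -(eq_mul p' p erefl ht) -(eq_mul q' q hs erefl).
exact: (@nt_nat _ _ _ _ al z p' q').
Qed.

Section VerticalComposition.
Variables (m1 m2 m3 : full_morphism G H).
Variables (al : fm_arrow m1 m2) (be : fm_arrow m2 m3).

Lemma vcomp_subproof k1 k2 k3
    (e12 : fobj (fm_psi m1) k1 = fobj (fm_psi m2) k2)
    (e23 : fobj (fm_psi m2) k2 = fobj (fm_psi m3) k3) :
  tgt (fm_app al e12) = src (fm_app be e23).
Proof. by rewrite fm_app_tgt fm_app_src. Qed.

Definition vcomp_via k1 k2 k3
    (e12 : fobj (fm_psi m1) k1 = fobj (fm_psi m2) k2)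
    (e23 : fobj (fm_psi m2) k2 = fobj (fm_psi m3) k3) : arr H :=
  mul (fm_app al e12) (fm_app be e23) (vcomp_subproof e12 e23).

Lemma vcomp_via_nat (x1 : arr (fm_mid m1)) (x3 : arr (fm_mid m3))
    k1 k2 k3 k1' k2' k3'
    (ex : farr (fm_psi m1) x1 = farr (fm_psi m3) x3)
    (s1 : src x1 = k1) (t1 : tgt x1 = k1') (s3 : src x3 = k3) (t3 : tgt x3 = k3')
    (e12 : fobj (fm_psi m1) k1 = fobj (fm_psi m2) k2)
    (e23 : fobj (fm_psi m2) k2 = fobj (fm_psi m3) k3)
    (e12' : fobj (fm_psi m1) k1' = fobj (fm_psi m2) k2')
    (e23' : fobj (fm_psi m2) k2' = fobj (fm_psi m3) k3') p q :
  mul (farr (fm_u m1) x1) (vcomp_via e12' e23') p =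
  mul (vcomp_via e12 e23) (farr (fm_u m3) x3) q.
Proof.
case: (fm_full m2) => [[_ ff] _].
have /(ff k2 k2') : src (farr (fm_psi m1) x1) = fobj (fm_psi m2) k2.
  by rewrite f_src s1.
case; first by rewrite f_tgt t1.
move=> x2 [[s2 [t2 ex2]] _].
have p1 : tgt (farr (fm_u m1) x1) = src (fm_app al e12').
  by rewrite f_tgt fm_app_src t1.
have p2 : tgt (fm_app al e12) = src (farr (fm_u m2) x2).
  by rewrite f_src fm_app_tgt s2.
have p3 : tgt (farr (fm_u m2) x2) = src (fm_app be e23').
  by rewrite f_tgt fm_app_src t2.
have p4 : tgt (fm_app be e23) = src (farr (fm_u m3) x3).
  by rewrite f_src fm_app_tgt s3.
have h1 : mul _ _ p1 = mul _ _ p2 by apply: (fm_app_nat (esym ex2)).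
have h2 : mul _ _ p3 = mul _ _ p4 by apply: (fm_app_nat (etrans ex2 ex)).
have r1 : tgt (mul _ _ p1) = src (fm_app be e23').
  by rewrite tgt_mul fm_app_tgt fm_app_src.
have r2 : tgt (mul _ _ p2) = src (fm_app be e23') by rewrite -h1.
have r3 : tgt (fm_app al e12) = src (mul _ _ p3) by rewrite src_mul.
have r4 : tgt (fm_app al e12) = src (mul _ _ p4) by rewrite -h2.
rewrite /vcomp_via -(mulA r1 p).
rewrite (eq_mul r1 r2 h1 erefl) (mulA r2 r3) (eq_mul r3 r4 erefl h2).
by rewrite -(mulA q r4).
Qed.

Lemma vcomp_via_indep k1 k2 k2' k3
    (e12 : fobj (fm_psi m1) k1 = fobj (fm_psi m2) k2)
    (e23 : fobj (fm_psi m2) k2 = fobj (fm_psi m3) k3)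
    (e12' : fobj (fm_psi m1) k1 = fobj (fm_psi m2) k2')
    (e23' : fobj (fm_psi m2) k2' = fobj (fm_psi m3) k3) :
  vcomp_via e12 e23 = vcomp_via e12' e23'.
Proof.
have ex : farr (fm_psi m1) (one k1) = farr (fm_psi m3) (one k3).
  by rewrite !f_one e12 e23.
have p : tgt (farr (fm_u m1) (one k1)) = src (vcomp_via e12' e23').
  by rewrite src_mul fm_app_src f_tgt tgt_one.
have q : tgt (vcomp_via e12 e23) = src (farr (fm_u m3) (one k3)).
  by rewrite tgt_mul fm_app_tgt f_src src_one.
have := vcomp_via_nat ex (src_one _) (tgt_one _) (src_one _) (tgt_one _) p q.
have p' : tgt (one (fobj (fm_u m1) k1)) = src (vcomp_via e12' e23').
  by rewrite -f_one.
have q' : tgt (vcomp_via e12 e23) = src (one (fobj (fm_u m3) k3)).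
  by rewrite -f_one.
rewrite (eq_mul p p' (f_one _ _) erefl) (eq_mul q q' erefl (f_one _ _)).
by rewrite mul1 mulx1.
Qed.

(* An arbitrary choice of the intermediate object; [vcompE] below shows that the
   composite does not depend on it. *)
Definition vcomp_mid (g : obj G) : {k2 | fobj (fm_psi m2) k2 = g} :=
  constructive_indefinite_description _ (proj2 (fm_full m2) g).

Definition vcomp_map (p : fp_obj (fm_psi m1) (fm_psi m3)) : arr H :=
  let: exist _ k2 e2 := vcomp_mid (fobj (fm_psi m1) (fp_fst p)) in
  vcomp_via (esym e2) (etrans e2 (proj2_sig p)).

Lemma vcomp_mapE k1 k2 k3
    (e13 : fobj (fm_psi m1) k1 = fobj (fm_psi m3) k3)
    (e12 : fobj (fm_psi m1) k1 = fobj (fm_psi m2) k2)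
    (e23 : fobj (fm_psi m2) k2 = fobj (fm_psi m3) k3) :
  vcomp_map (fp_pair e13) = vcomp_via e12 e23.
Proof. by rewrite /vcomp_map; case: vcomp_mid => k e; apply: vcomp_via_indep. Qed.

Lemma vcomp_src (p : fp_obj (fm_psi m1) (fm_psi m3)) :
  src (vcomp_map p) = fobj (fm_u m1) (fp_fst p).
Proof. by rewrite /vcomp_map; case: vcomp_mid => k e; rewrite src_mul fm_app_src. Qed.

Lemma vcomp_tgt (p : fp_obj (fm_psi m1) (fm_psi m3)) :
  tgt (vcomp_map p) = fobj (fm_u m3) (fp_snd p).
Proof. by rewrite /vcomp_map; case: vcomp_mid => k e; rewrite tgt_mul fm_app_tgt. Qed.

Lemma vcomp_nat (x : fp_arr (fm_psi m1) (fm_psi m3)) e e' :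
  mul (farr (fm_u m1) (fp_farr1 x)) (vcomp_map (fp_tgt x)) e =
  mul (vcomp_map (fp_src x)) (farr (fm_u m3) (fp_farr2 x)) e'.
Proof.
move: e e'; rewrite /vcomp_map; case: vcomp_mid => k2 e2; case: vcomp_mid => k2' e2'.
by move=> e e'; apply: vcomp_via_nat => //; apply: (proj2_sig x).
Qed.

Definition vcomp : fm_arrow m1 m3 :=
  @NatTrans _ _
    (compm (fp_proj1 (fm_psi m1) (fm_psi m3)) (fm_u m1))
    (compm (fp_proj2 (fm_psi m1) (fm_psi m3)) (fm_u m3))
    vcomp_map vcomp_src vcomp_tgt vcomp_nat.

Lemma vcompE k1 k2 k3
    (e13 : fobj (fm_psi m1) k1 = fobj (fm_psi m3) k3)
    (e12 : fobj (fm_psi m1) k1 = fobj (fm_psi m2) k2)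
    (e23 : fobj (fm_psi m2) k2 = fobj (fm_psi m3) k3) e :
  fm_app vcomp e13 = mul (fm_app al e12) (fm_app be e23) e.
Proof. by rewrite [LHS](vcomp_mapE e13 e12 e23); apply: eq_mul. Qed.
End VerticalComposition.
End FullMorphisms.

Definition FMor0 (G H : groupoid) : Type := full_morphism G H.

Record FMor1 (G H : groupoid) : Type := FMorArrow {
  fmor_src : FMor0 G H;
  fmor_tgt : FMor0 G H;
  fmor_arrow : fm_arrow fmor_src fmor_tgt
}.

(* The second factor is transported along [e] so that [vcomp] applies. *)
Definition fmor_mul (G H : groupoid) (a b : FMor1 G H)
    (e : fmor_tgt a = fmor_src b) : FMor1 G H :=
  FMorArrow (vcomp (fmor_arrow a)
    (eq_rect_r (fun m => fm_arrow m (fmor_tgt b)) (fmor_arrow b) e)).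

(* Main.v *)
From Stdlib Require Import ssreflect ssrfun ProofIrrelevance ClassicalEpsilon.
From Stdlib Require Import FunctionalExtensionality.
Require Import Defs.

(** Since the vertical composite may be computed through any intermediate object
    ([vcompE]), each law reduces to an identity between arrows of [H] once the
    intermediate objects are well chosen.

    The identity of a full-morphism [(psi, K, u)] cannot be the family of unit
    arrows of [H], as [k1] and [k2] in a pair with [psi k1 = psi k2] need not be
    equal.  But [psi] is fully faithful, so there is a unique arrow
    [vertical_arr : k1 -> k2] that [psi] sends to a unit, and the identity is its
    image under [u]; naturality holds because [psi] is faithful.  On the diagonal
    the vertical arrow is a unit ([fm_id_diag]), so choosing the intermediate
    object on the diagonal gives the unit laws.  Associativity in [H] gives
    associativity, surjectivity of each [psi] on objects providing the
    intermediate objects.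

    The inverse of [al] is [(k2, k1) |-> (al (k1, k2))^-1].  Naturality of [al]
    along the pair formed by a vertical arrow [k1 -> k3] and a unit at [k2] says
    that [al (k1, k2)] is [u] of that vertical arrow followed by [al (k3, k2)];
    hence the composite of [al] with its inverse is the identity
    ([vcomp_fm_inv]).  As inversion is an involution, the composite in the other
    order is the identity too. *)

Set Implicit Arguments.
Unset Strict Implicit.
Unset Printing Implicit Defensive.

(** * Inverses in a groupoid *)

Section Inverse.
Variable G : groupoid.
Implicit Types x y a b : arr G.

Definition inv x : arr G :=
  proj1_sig (constructive_indefinite_description _ (proj2 (groupoidP G) x)).

Lemma src_inv x : src (inv x) = tgt x.
Proof. by rewrite /inv; case: constructive_indefinite_description => y []. Qed.

Lemma tgt_inv x : tgt (inv x) = src x.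
Proof. by rewrite /inv; case: constructive_indefinite_description => y [? []]. Qed.

Lemma mulxV x e : mul x (inv x) e = one (src x).
Proof.
move: e; rewrite /inv; case: constructive_indefinite_description.
by move=> y [p [q [h _]]] /= e; rewrite -h; apply: eq_mul.
Qed.

Lemma mulVx x e : mul (inv x) x e = one (tgt x).
Proof.
move: e; rewrite /inv; case: constructive_indefinite_description.
by move=> y [p [q [_ h]]] /= e; rewrite -h; apply: eq_mul.
Qed.

Lemma mulKx x y e e' : mul (inv x) (mul x y e) e' = y.
Proof.
have p : tgt (inv x) = src x by rewrite tgt_inv.
have q : tgt (mul (inv x) x p) = src y by rewrite tgt_mul.
have r : tgt (one (tgt x)) = src y by rewrite tgt_one.
by rewrite -(mulA q e') (eq_mul q r (mulVx p) erefl) mul1.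
Qed.

Lemma mulxK x y e e' : mul (mul x y e) (inv y) e' = x.
Proof.
have p : tgt y = src (inv y) by rewrite src_inv.
have q : tgt x = src (mul y (inv y) p) by rewrite src_mul.
have r : tgt x = src (one (src y)) by rewrite src_one.
by rewrite (mulA e' q) (eq_mul q r erefl (mulxV p)) mulx1.
Qed.

Lemma invK x : inv (inv x) = x.
Proof.
have p : tgt (inv x) = src x by rewrite tgt_inv.
have q : tgt (inv (inv x)) = src (mul (inv x) x p).
  by rewrite tgt_inv src_mul.
have r : tgt (inv (inv x)) = src (one (tgt x)).
  by rewrite tgt_inv src_inv src_one.
by rewrite -[RHS](mulKx q) (eq_mul q r erefl (mulVx p)) mulx1.
Qed.

(** A commutative square stays commutative when two parallel sides are
    inverted; this is what makes the inverse of a transformation natural. *)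
Lemma square_inv x y a b exb eay e e' :
  mul x b exb = mul a y eay -> mul y (inv b) e = mul (inv a) x e'.
Proof.
move=> sq.
have p : tgt (inv a) = src (mul a y eay) by rewrite tgt_inv src_mul.
have q : tgt (inv a) = src (mul x b exb) by rewrite sq.
have yE : mul (inv a) (mul x b exb) q = y.
  by rewrite -[RHS](mulKx p); apply: eq_mul.
have r : tgt (mul (inv a) (mul x b exb) q) = src (inv b) by rewrite yE.
have r' : tgt (mul x b exb) = src (inv b) by rewrite tgt_mul src_inv.
have r'' : tgt (inv a) = src (mul (mul x b exb) (inv b) r') by rewrite src_mul.
by rewrite -(eq_mul r e yE erefl) (mulA r r''); apply: eq_mul; rewrite ?mulxK.
Qed.
End Inverse.

(** * Arrows lying over a unit *)

Section VerticalArrow.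
Variables (K G : groupoid) (f : morphism K G).
Hypothesis f_equiv : is_equivalence f.

Lemma equivalence_faithful (x y : arr K) :
  src x = src y -> tgt x = tgt y -> farr f x = farr f y -> x = y.
Proof.
move=> es et ef; case: (f_equiv) => _ ff.
have [z [_ zU]] := ff (src y) (tgt y) (farr f y) (f_src _ _) (f_tgt _ _).
by rewrite -(zU x) // -(zU y).
Qed.

Lemma vertical_arr_ex (k k' : obj K) (e : fobj f k = fobj f k') :
  exists x : arr K, src x = k /\ tgt x = k' /\ farr f x = one (fobj f k).
Proof.
case: (f_equiv) => _ ff.
have [|x [hx _]] := ff k k' (one (fobj f k)) (src_one _).
  by rewrite tgt_one.
by exists x.
Qed.

Definition vertical_arr (k k' : obj K) (e : fobj f k = fobj f k') : arr K :=
  proj1_sig (constructive_indefinite_description _ (vertical_arr_ex e)).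

Section Spec.
Variables (k k' : obj K) (e : fobj f k = fobj f k').

Lemma src_vertical_arr : src (vertical_arr e) = k.
Proof. by rewrite /vertical_arr; case: constructive_indefinite_description => x []. Qed.

Lemma tgt_vertical_arr : tgt (vertical_arr e) = k'.
Proof.
by rewrite /vertical_arr; case: constructive_indefinite_description => x [? []].
Qed.

Lemma farr_vertical_arr : farr f (vertical_arr e) = one (fobj f k).
Proof.
by rewrite /vertical_arr; case: constructive_indefinite_description => x [? []].
Qed.
End Spec.

Lemma vertical_arr_diag (k : obj K) (e : fobj f k = fobj f k) :
  vertical_arr e = one k.
Proof.
apply: equivalence_faithful.
- by rewrite src_vertical_arr src_one.
- by rewrite tgt_vertical_arr tgt_one.
- by rewrite farr_vertical_arr f_one.
Qed.

(** Both composites lie over the common image of [x] and [y] under [f], so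
    faithfulness identifies them. *)
Lemma vertical_arr_nat (x y : arr K)
    (es : fobj f (src x) = fobj f (src y)) (et : fobj f (tgt x) = fobj f (tgt y))
    p q :
  farr f x = farr f y ->
  mul x (vertical_arr et) p = mul (vertical_arr es) y q.
Proof.
move=> exy; apply: equivalence_faithful.
- by rewrite !src_mul src_vertical_arr.
- by rewrite !tgt_mul tgt_vertical_arr.
- have p' : tgt (farr f x) = src (farr f (vertical_arr et)).
    by rewrite f_tgt f_src src_vertical_arr.
  have q' : tgt (farr f (vertical_arr es)) = src (farr f y).
    by rewrite f_tgt f_src tgt_vertical_arr.
  have p'' : tgt (farr f x) = src (one (fobj f (tgt x))) by rewrite f_tgt src_one.
  have q'' : tgt (one (fobj f (src x))) = src (farr f y) by rewrite tgt_one f_src.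
  rewrite (f_mul f p p') (f_mul f q q').
  rewrite (eq_mul p' p'' erefl (farr_vertical_arr et)).
  by rewrite (eq_mul q' q'' (farr_vertical_arr es) erefl) mul1 mulx1.
Qed.
End VerticalArrow.

(** * Identities, units, associativity and inverses for vertical composition *)

Section FMor.
Variables G H : groupoid.
Implicit Types m : full_morphism G H.

Lemma nat_trans_eq (K : groupoid) (f g : morphism K H) (al be : nat_trans f g) :
  (forall a, nt_map al a = nt_map be a) -> al = be.
Proof.
case: al => a a1 a2 a3; case: be => b b1 b2 b3 /= eab.
have {}eab : a = b by apply: functional_extensionality.
subst b; rewrite (proof_irrelevance _ b1 a1) (proof_irrelevance _ b2 a2).
by rewrite (proof_irrelevance _ b3 a3).
Qed.

Lemma fm_arrow_eq m1 m2 (al be : fm_arrow m1 m2) :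
  (forall k1 k2 (e : fobj (fm_psi m1) k1 = fobj (fm_psi m2) k2),
     fm_app al e = fm_app be e) -> al = be.
Proof. by move=> eab; apply: nat_trans_eq => [[[k1 k2] e]]; apply: eab. Qed.

Section Identity.
Variable m : full_morphism G H.
Let psi := fm_psi m.
Let psi_equiv : is_equivalence psi := proj1 (fm_full m).

Definition fm_id_map (p : fp_obj psi psi) : arr H :=
  farr (fm_u m) (vertical_arr psi_equiv (proj2_sig p)).

Lemma fm_id_src p : src (fm_id_map p) = fobj (fm_u m) (fp_fst p).
Proof. by rewrite f_src src_vertical_arr. Qed.

Lemma fm_id_tgt p : tgt (fm_id_map p) = fobj (fm_u m) (fp_snd p).
Proof. by rewrite f_tgt tgt_vertical_arr. Qed.

Lemma fm_id_nat (x : fp_arr psi psi) e e' :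
  mul (farr (fm_u m) (fp_farr1 x)) (fm_id_map (fp_tgt x)) e =
  mul (fm_id_map (fp_src x)) (farr (fm_u m) (fp_farr2 x)) e'.
Proof.
have p : tgt (fp_farr1 x) =
         src (vertical_arr psi_equiv (proj2_sig (fp_tgt x))).
  by rewrite src_vertical_arr.
have q : tgt (vertical_arr psi_equiv (proj2_sig (fp_src x))) =
         src (fp_farr2 x).
  by rewrite tgt_vertical_arr.
rewrite -(f_mul (fm_u m) p e) -(f_mul (fm_u m) q e').
by congr (farr _ _); apply: vertical_arr_nat; apply: (proj2_sig x).
Qed.

Definition fm_id : fm_arrow m m :=
  @NatTrans _ _ (compm (fp_proj1 psi psi) (fm_u m))
    (compm (fp_proj2 psi psi) (fm_u m))
    fm_id_map fm_id_src fm_id_tgt fm_id_nat.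

Lemma fm_id_diag k (e : fobj psi k = fobj psi k) :
  fm_app fm_id e = one (fobj (fm_u m) k).
Proof. by rewrite -f_one -(vertical_arr_diag psi_equiv e). Qed.
End Identity.

Lemma fm_id_vcomp m1 m2 (al : fm_arrow m1 m2) : vcomp (fm_id m1) al = al.
Proof.
apply: fm_arrow_eq => k1 k2 e.
have p : tgt (fm_app (fm_id m1) (erefl (fobj (fm_psi m1) k1))) =
         src (fm_app al e) by rewrite fm_app_src fm_app_tgt.
have q : tgt (one (fobj (fm_u m1) k1)) = src (fm_app al e).
  by rewrite tgt_one fm_app_src.
by rewrite (vcompE e p) (eq_mul p q (fm_id_diag _) erefl) mul1.
Qed.

Lemma vcomp_fm_id m1 m2 (al : fm_arrow m1 m2) : vcomp al (fm_id m2) = al.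
Proof.
apply: fm_arrow_eq => k1 k2 e.
have p : tgt (fm_app al e) =
         src (fm_app (fm_id m2) (erefl (fobj (fm_psi m2) k2))).
  by rewrite fm_app_src fm_app_tgt.
have q : tgt (fm_app al e) = src (one (fobj (fm_u m2) k2)).
  by rewrite src_one fm_app_tgt.
by rewrite (vcompE e p) (eq_mul p q erefl (fm_id_diag _)) mulx1.
Qed.

Lemma vcompA m1 m2 m3 m4
    (al : fm_arrow m1 m2) (be : fm_arrow m2 m3) (ga : fm_arrow m3 m4) :
  vcomp (vcomp al be) ga = vcomp al (vcomp be ga).
Proof.
apply: fm_arrow_eq => k1 k4 e14.
have [k2 e2] := proj2 (fm_full m2) (fobj (fm_psi m1) k1).
have [k3 e3] := proj2 (fm_full m3) (fobj (fm_psi m1) k1).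
have e12 := esym e2; have e13 := esym e3.
have e23 : fobj (fm_psi m2) k2 = fobj (fm_psi m3) k3 by rewrite e2 e3.
have e34 : fobj (fm_psi m3) k3 = fobj (fm_psi m4) k4 by rewrite e3.
have e24 : fobj (fm_psi m2) k2 = fobj (fm_psi m4) k4 by rewrite e2.
have pab : tgt (fm_app al e12) = src (fm_app be e23).
  by rewrite fm_app_tgt fm_app_src.
have pbc : tgt (fm_app be e23) = src (fm_app ga e34).
  by rewrite fm_app_tgt fm_app_src.
have p1 : tgt (fm_app (vcomp al be) e13) = src (fm_app ga e34).
  by rewrite fm_app_tgt fm_app_src.
have p2 : tgt (fm_app al e12) = src (fm_app (vcomp be ga) e24).
  by rewrite fm_app_tgt fm_app_src.
have q1 : tgt (mul _ _ pab) = src (fm_app ga e34) by rewrite tgt_mul.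
have q2 : tgt (fm_app al e12) = src (mul _ _ pbc) by rewrite src_mul.
rewrite (vcompE e14 p1) (vcompE e14 p2).
rewrite (eq_mul p1 q1 (vcompE e13 pab) erefl).
by rewrite (eq_mul p2 q2 erefl (vcompE e24 pbc)); apply: mulA.
Qed.

Section InverseArrow.
Variables (m1 m2 : full_morphism G H) (al : fm_arrow m1 m2).

Definition fm_inv_map (p : fp_obj (fm_psi m2) (fm_psi m1)) : arr H :=
  inv (fm_app al (esym (proj2_sig p))).

Lemma fm_inv_src p : src (fm_inv_map p) = fobj (fm_u m2) (fp_fst p).
Proof. by rewrite src_inv fm_app_tgt. Qed.

Lemma fm_inv_tgt p : tgt (fm_inv_map p) = fobj (fm_u m1) (fp_snd p).
Proof. by rewrite tgt_inv fm_app_src. Qed.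

Lemma fm_inv_nat (x : fp_arr (fm_psi m2) (fm_psi m1)) e e' :
  mul (farr (fm_u m2) (fp_farr1 x)) (fm_inv_map (fp_tgt x)) e =
  mul (fm_inv_map (fp_src x)) (farr (fm_u m1) (fp_farr2 x)) e'.
Proof.
have p : tgt (farr (fm_u m1) (fp_farr2 x)) =
         src (fm_app al (esym (proj2_sig (fp_tgt x)))).
  by rewrite fm_app_src f_tgt.
have q : tgt (fm_app al (esym (proj2_sig (fp_src x)))) =
         src (farr (fm_u m2) (fp_farr1 x)).
  by rewrite fm_app_tgt f_src.
apply: (@square_inv _ _ _ _ _ p q).
by apply: fm_app_nat => //; apply: esym (proj2_sig x).
Qed.

Definition fm_inv : fm_arrow m2 m1 :=
  @NatTrans _ _
    (compm (fp_proj1 (fm_psi m2) (fm_psi m1)) (fm_u m2))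
    (compm (fp_proj2 (fm_psi m2) (fm_psi m1)) (fm_u m1))
    fm_inv_map fm_inv_src fm_inv_tgt fm_inv_nat.

Lemma fm_invE k1 k2 (e : fobj (fm_psi m2) k2 = fobj (fm_psi m1) k1)
    (e' : fobj (fm_psi m1) k1 = fobj (fm_psi m2) k2) :
  fm_app fm_inv e = inv (fm_app al e').
Proof. by rewrite (proof_irrelevance _ e' (esym e)). Qed.

(** For any [k2] over the common image of [k1] and [k3], naturality of [al]
    along the vertical arrow [d : k1 -> k3] and the unit at [k2] gives
    [al (k1, k2) = u d * al (k3, k2)]; cancelling [al (k3, k2)] leaves [u d]. *)
Lemma vcomp_fm_inv : vcomp al fm_inv = fm_id m1.
Proof.
apply: fm_arrow_eq => k1 k3 e13.
have [k2 e2] := proj2 (fm_full m2) (fobj (fm_psi m1) k1).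
have e12 := esym e2.
have e32 : fobj (fm_psi m1) k3 = fobj (fm_psi m2) k2 by rewrite e2.
have e23 := esym e32.
pose d := vertical_arr (proj1 (fm_full m1)) e13.
have dE : fm_app (fm_id m1) e13 = farr (fm_u m1) d by [].
have ex : farr (fm_psi m1) d = farr (fm_psi m2) (one k2).
  by rewrite farr_vertical_arr f_one e2.
have p : tgt (farr (fm_u m1) d) = src (fm_app al e32).
  by rewrite f_tgt tgt_vertical_arr fm_app_src.
have q : tgt (fm_app al e12) = src (farr (fm_u m2) (one k2)).
  by rewrite fm_app_tgt f_src src_one.
have q' : tgt (fm_app al e12) = src (one (fobj (fm_u m2) k2)).
  by rewrite -f_one.
have sq : mul (farr (fm_u m1) d) (fm_app al e32) p = fm_app al e12.
  have ds : src d = k1 := src_vertical_arr _ _.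
  have dt : tgt d = k3 := tgt_vertical_arr _ _.
  rewrite (fm_app_nat ex ds dt (src_one _) (tgt_one _) p q).
  by rewrite (eq_mul q q' erefl (f_one _ _)) mulx1.
have r : tgt (fm_app al e12) = src (fm_app fm_inv e23).
  by rewrite fm_app_tgt fm_app_src.
have r' : tgt (mul _ _ p) = src (inv (fm_app al e32)).
  by rewrite tgt_mul src_inv.
rewrite dE (vcompE e13 r).
by rewrite (eq_mul r r' (esym sq) (fm_invE e23 e32)) mulxK.
Qed.
End InverseArrow.

Lemma fm_invK m1 m2 (al : fm_arrow m1 m2) : fm_inv (fm_inv al) = al.
Proof.
by apply: fm_arrow_eq => k1 k2 e; rewrite (fm_invE _ e (esym e)) (fm_invE _ _ e) invK.
Qed.

Lemma fm_inv_vcomp m1 m2 (al : fm_arrow m1 m2) : vcomp (fm_inv al) al = fm_id m2.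
Proof. by rewrite -[X in vcomp _ X](fm_invK al); apply: vcomp_fm_inv. Qed.

(** On arrows whose endpoints match syntactically, the transport in [fmor_mul]
    disappears whatever the proof of composability. *)
Lemma fmor_mulE m1 m2 m3 (al : fm_arrow m1 m2) (be : fm_arrow m2 m3)
    (e : fmor_tgt (FMorArrow al) = fmor_src (FMorArrow be)) :
  fmor_mul e = FMorArrow (vcomp al be).
Proof. by rewrite (proof_irrelevance _ e erefl). Qed.
End FMor.

Theorem theorem3p14 (G H : groupoid) :
  exists one_FMor : FMor0 G H -> FMor1 G H,
    is_groupoid (@fmor_src G H) (@fmor_tgt G H) one_FMor (@fmor_mul G H).
Proof.
exists (fun m => FMorArrow (fm_id m)); split; first split=> //.
- by case=> m1 m2 al e; rewrite fmor_mulE fm_id_vcomp.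
- by case=> m1 m2 al e; rewrite fmor_mulE vcomp_fm_id.
- case=> m1 m2 al [m2' m3 be] [m3' m4 ga] exy eyz.
  (* Once the endpoints match, every composability proof may be taken to be
     [erefl], which makes the transports compute. *)
  have h : m2 = m2' := exy; have h' : m3 = m3' := eyz; subst m2' m3'.
  rewrite (proof_irrelevance _ exy erefl) (proof_irrelevance _ eyz erefl) => e1 e2.
  rewrite (proof_irrelevance _ e1 erefl) (proof_irrelevance _ e2 erefl).
  exact: (f_equal (@FMorArrow G H m1 m4) (vcompA al be ga)).
- case=> m1 m2 al; exists (FMorArrow (fm_inv al)), erefl, erefl.
  by rewrite !fmor_mulE vcomp_fm_inv fm_inv_vcomp.
Qed.
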